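(* Let $\alpha: I\to\mathbb{R}^3$ be a Frenet curve parametrized by arc length and let $\gamma: I\to\mathbb{R}^3$ be an osculating-direction curve of $\alpha$. Then the following are equivalent: (i) $\alpha$ is a general helix in $E^3$; (ii) $\alpha$ is an osculating-donor curve of a slant helix; (iii) the osculating-direction curve $\gamma$ of $\alpha$ is a slant helix.
   Context: $E^3$ is Euclidean 3-space, $I\subset\mathbb{R}$ is an open interval and curves are sufficiently smooth. A unit speed curve $\alpha: I\to\mathbb{R}^3$ is a Frenet curve if its curvature $\kappa(s)=\|\alpha''(s)\|$ is nowhere zero; its Frenet frame is $T=\alpha'$, $N=\alpha''/\kappa$, $B=T\times N$, with $T'=\kappa N$, $N'=-\kappa T+\tau B$, $B'=-\tau N$, where $\tau$ is the torsion. Osculating-direction curve: let $X$ be a unit vector field along $\alpha$ of the form $X(s)=u(s)T(s)+v(s)N(s)$ with $u,v$ differentiable, $u(s)\neq0$, $v(s)\neq0$, and such that $X'(s)$ is a nonzero multiple of $B(s)$ for every $s\in I$. An integral curve $\gamma: I\to\mathbb{R}^3$ of $X$, i.e. a curve with $\gamma'(s)=X(s)$, is called an osculating-direction curve of $\alpha$, and $\alpha$ is called an osculating-donor curve of $\gamma$. Such $\gamma$ is itself a Frenet curve with arc length parameter $s$. A unit speed curve with unit tangent $T$ is a general helix if there is a constant (unit) vector $w$ such that $\langle T,w\rangle=\cos\theta$ is constant along the curve with $\theta\neq\pi/2$. A curve with nowhere zero curvature is a slant helix if its principal normal lines make a constant angle with a fixed direction. *)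

(* Defs.v *)
From HB Require Import structures.
From mathcomp Require Import all_boot all_order all_algebra.
From mathcomp Require Import all_classical all_reals all_analysis.

Set Implicit Arguments.
Unset Strict Implicit.
Unset Printing Implicit Defensive.

Import Order.TTheory GRing.Theory Num.Theory.
Import numFieldNormedType.Exports.

Local Open Scope ring_scope.
Local Open Scope classical_set_scope.

Section Vectors.
Context {R : realType}.
Implicit Types u v : 'rV[R]_3.

Definition dot u v : R := \sum_i u 0 i * v 0 i.

(* The library norm on row vectors is the sup norm, hence this definition;
   both norms yield the same derivatives. *)
Definition enorm u : R := Num.sqrt (dot u u).

(* The indices are computed modulo 3, in the additive group of 'I_3. *)
Definition cross u v : 'rV[R]_3 :=
  \row_(k < 3) (u 0 (k + 1) * v 0 (k + 2) - u 0 (k + 2) * v 0 (k + 1)).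

End Vectors.

(* A curve on I is represented by a total function on R, of which only the
   values on the open set I matter. *)
Section Curves.
Context {R : realType}.
Implicit Types (I : set R) (alpha gamma X : R -> 'rV[R]_3) (s : R) (k : nat).

Definition class_C k I alpha : Prop :=
  (forall n s, (n < k)%N -> I s -> derivable alpha^`(n) s 1) /\
  (forall s, I s -> {for s, continuous alpha^`(k)}).

Definition tangent alpha s : 'rV[R]_3 := alpha^`()%classic s.

Definition curvature alpha s : R := enorm (alpha^`(2)%classic s).

Definition normal alpha s : 'rV[R]_3 := (curvature alpha s)^-1 *: alpha^`(2)%classic s.

Definition binormal alpha s : 'rV[R]_3 :=
  cross (tangent alpha s) (normal alpha s).

Definition unit_speed I alpha : Prop :=
  forall s, I s -> enorm (tangent alpha s) = 1.

(* Class C^3 is what the derivative formulas of the Frenet frame require. *)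
Definition Frenet_curve I alpha : Prop :=
  [/\ class_C 3 I alpha, unit_speed I alpha &
      forall s, I s -> curvature alpha s != 0].

Definition osculating_direction_field I alpha X : Prop :=
  exists u v : R -> R,
    forall s, I s ->
      [/\ derivable u s 1 /\ derivable v s 1,
          u s != 0 /\ v s != 0,
          X s = u s *: tangent alpha s + v s *: normal alpha s,
          enorm (X s) = 1 &
          exists2 c : R, c != 0 & is_derive s 1 X (c *: binormal alpha s)].

Definition osculating_direction_curve I alpha gamma : Prop :=
  exists2 X, osculating_direction_field I alpha X &
    forall s, I s -> is_derive s 1 gamma (X s).

Definition osculating_donor_curve I gamma alpha : Prop :=
  osculating_direction_curve I alpha gamma.

Definition general_helix I alpha : Prop :=
  [/\ class_C 1 I alpha, unit_speed I alpha &
      exists (w : 'rV[R]_3) (theta : R),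
        [/\ enorm w = 1, 0 <= theta <= pi, theta != pi / 2 &
            forall s, I s -> dot (tangent alpha s) w = cos theta]].

(* The principal normal lines are oriented by the principal normal vector;
   class C^2 suffices for that vector to be defined and continuous. *)
Definition slant_helix I gamma : Prop :=
  [/\ class_C 2 I gamma, unit_speed I gamma,
      forall s, I s -> curvature gamma s != 0 &
      exists (w : 'rV[R]_3) (theta : R),
        [/\ enorm w = 1, 0 <= theta <= pi &
            forall s, I s -> dot (normal gamma s) w = cos theta]].

End Curves.

(* Main.v *)
(* Write gamma' = X = u T + v N.  Differentiating <X, B> = 0 gives
   gamma'' = v tau B; hence v tau vanishes nowhere, the principal normal of
   gamma is B up to a locally constant sign, and its derivative is a nonzero
   multiple of N, as is T'.  For a fixed vector w, both <T, w> and <N_gamma, w>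
   are therefore constant on the interval exactly when <N, w> = 0 there.  The
   constant <T, w> is then nonzero: otherwise w = <B, w> B, and <N', w> = 0
   forces tau <B, w> = 0, hence w = 0. *)
Require Import Defs.
From mathcomp Require Import all_boot all_order all_algebra ring lra.
From mathcomp Require Import all_classical all_reals all_analysis.
Import Order.TTheory GRing.Theory Num.Theory.
Import numFieldNormedType.Exports.
Local Open Scope ring_scope.
Local Open Scope classical_set_scope.

(** * Algebra of the dot and cross products in coordinates *)

Section Vectors.
Context {R : realType}.
Implicit Types (u v w : 'rV[R]_3) (a : R).

Lemma dot3E u v : dot u v = u 0 0 * v 0 0 + u 0 1 * v 0 1 + u 0 2 * v 0 2.
Proof.
rewrite /dot !big_ord_recl big_ord0 addr0 addrA.
by congr (_ + u 0 _ * v 0 _ + u 0 _ * v 0 _); apply: val_inj.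
Qed.

(** Together with [dot3E], this evaluates the indices modulo 3, so that vector identities become
    polynomial identities for [ring]. *)
Lemma cross3E u v :
  [/\ cross u v 0 0 = u 0 1 * v 0 2 - u 0 2 * v 0 1,
      cross u v 0 1 = u 0 2 * v 0 0 - u 0 0 * v 0 2 &
      cross u v 0 2 = u 0 0 * v 0 1 - u 0 1 * v 0 0].
Proof.
by split; rewrite mxE;
  congr (u 0 _ * v 0 _ - u 0 _ * v 0 _); apply: val_inj.
Qed.

Lemma dotC u v : dot u v = dot v u.
Proof. by apply: eq_bigr => i _; rewrite mulrC. Qed.

Lemma dotDl u v w : dot (u + v) w = dot u w + dot v w.
Proof. by rewrite !dot3E !mxE; ring. Qed.

Lemma dotZl a u w : dot (a *: u) w = a * dot u w.
Proof. by rewrite !dot3E !mxE; ring. Qed.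

Lemma dotZr a u w : dot w (a *: u) = a * dot w u.
Proof. by rewrite dotC dotZl (dotC w). Qed.

Lemma dot0r w : dot w 0 = 0.
Proof. by rewrite -(scale0r 0) dotZr mul0r. Qed.

Lemma dot_ge0 u : 0 <= dot u u.
Proof. by apply: sumr_ge0 => i _; rewrite -expr2 sqr_ge0. Qed.

Lemma sqr_enorm u : enorm u ^+ 2 = dot u u.
Proof. by rewrite sqr_sqrtr ?dot_ge0. Qed.

Lemma dot_eq1 u : enorm u = 1 -> dot u u = 1.
Proof. by rewrite -sqr_enorm => ->; rewrite expr1n. Qed.

Lemma enormZ a u : enorm (a *: u) = `|a| * enorm u.
Proof. by rewrite /enorm dotZl dotZr mulrA -expr2 sqrtrM ?sqr_ge0// sqrtr_sqr. Qed.

Lemma dot_crossl u v : dot (cross u v) u = 0.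
Proof. by rewrite dot3E; have [-> -> ->] := cross3E u v; ring. Qed.

Lemma dot_crossr u v : dot (cross u v) v = 0.
Proof. by rewrite dot3E; have [-> -> ->] := cross3E u v; ring. Qed.

(** Lagrange's identity. It yields both the length of the binormal and the Cauchy-Schwarz
    inequality. *)
Lemma dot_cross2 u v :
  dot (cross u v) (cross u v) = dot u u * dot v v - dot u v ^+ 2.
Proof. by rewrite !dot3E; have [-> -> ->] := cross3E u v; ring. Qed.

(** The matrix [M] with rows u, v and u x v satisfies M M^T = 1. Being square, it also satisfies M^T
    M = 1, and w = (w M^T) M is the expansion, the entries of w M^T being the dot products of w with
    the rows. *)
Lemma orthonormal_expansion u v w : dot u u = 1 -> dot v v = 1 ->
    dot u v = 0 ->
  w = dot w u *: u + dot w v *: v + dot w (cross u v) *: cross u v.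
Proof.
move=> uu vv uv.
have cc : dot (cross u v) (cross u v) = 1.
  by rewrite dot_cross2 uu vv uv expr0n subr0 mulr1.
have cu := dot_crossl u v; have cv := dot_crossr u v.
set c := cross u v in cc cu cv *.
pose e (i : 'I_3) := if i == 0 then u else if i == 1 then v else c.
pose M := \matrix_i e i.
have MMT : M *m M^T = 1%:M.
  apply/matrixP => i j.
  have -> : (M *m M^T) i j = dot (e i) (e j).
    by rewrite mxE; apply: eq_bigr => k _; rewrite !mxE.
  rewrite mxE; case: i => -[|[|[|//]]] ?; case: j => -[|[|[|//]]] ? //=;
  by rewrite /e -?val_eqE /= ?[dot u c]dotC ?[dot v c]dotC ?[dot v u]dotC.
rewrite -[LHS]mulmx1 -(mulmx1C MMT) mulmxA.
have wM k : (w *m M^T) 0 k = dot w (e k).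
  by rewrite mxE; apply: eq_bigr => j _; rewrite !mxE.
apply/rowP => j; rewrite !mxE !big_ord_recl big_ord0 addr0 !wM !mxE addrA.
by rewrite /e -!val_eqE.
Qed.

Lemma unit_dot_angle u w : enorm u = 1 -> enorm w = 1 ->
  exists2 theta : R, 0 <= theta <= pi & dot u w = cos theta.
Proof.
move=> /dot_eq1 uu /dot_eq1 ww.
have d1 : -1 <= dot u w <= 1.
  (* Cauchy-Schwarz: the squared length 1 - <u, w>^2 of the cross product is nonnegative. *)
  have := dot_ge0 (cross u w); rewrite dot_cross2 uu ww mul1r subr_ge0.
  by move=> dd; apply/andP; split; nra.
exists (acos (dot u w)); first by rewrite acos_ge0// acos_lepi.
by rewrite acosK.
Qed.

End Vectors.

(** * Differentiation and continuity of vector-valued functions *)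

Section VectorCalculus.
Context {R : realType}.
Implicit Types (f g : R -> 'rV[R]_3) (h : R -> R) (s : R).

Lemma is_derive_coord f s df i j :
  is_derive s 1 f df -> is_derive s 1 (fun x => f x i j) (df i j).
Proof.
move=> [fs <-]; split; first exact: (derivable_mxP f s 1).1 fs i j.
by rewrite derive_mx// mxE.
Qed.

Lemma is_derive_dot f g s df dg :
  is_derive s 1 f df -> is_derive s 1 g dg ->
  is_derive s 1 (fun x => dot (f x) (g x)) (dot df (g s) + dot (f s) dg).
Proof.
move=> fs gs.
(* Written as a sum of products of functions, the dot product gets its derivative by instance
   inference from [fi] and [gi]. *)
have -> : (fun x => dot (f x) (g x)) =
    \sum_(i < 3) ((fun x => f x 0 i) * (fun x => g x 0 i)).
  by apply/funext => x; rewrite fct_sumE.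
have fi i := is_derive_coord f s df 0 i fs.
have gi i := is_derive_coord g s dg 0 i gs.
apply: is_derive_eq.
rewrite -big_split; apply: eq_bigr => i _ /=.
by rewrite addrC ![_ *: _]mulrC; congr (_ + _); rewrite mulrC.
Qed.

Lemma derivable_scale h f s :
  derivable h s 1 -> derivable f s 1 -> derivable (fun x => h x *: f x) s 1.
Proof.
move=> hs /derivable_mxP fs; apply/derivable_mxP => i j.
under eq_fun do rewrite mxE.
exact: derivableM.
Qed.

Lemma derivable_cross f g s :
  derivable f s 1 -> derivable g s 1 ->
  derivable (fun x => cross (f x) (g x)) s 1.
Proof.
move=> /derivable_mxP fs /derivable_mxP gs; apply/derivable_mxP => i j.
under eq_fun do rewrite mxE.
by apply: derivableB; apply: derivableM.
Qed.

Lemma continuous_dot f g s :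
  {for s, continuous f} -> {for s, continuous g} ->
  {for s, continuous (fun x => dot (f x) (g x))}.
Proof.
move=> fs gs.
have fi i : {for s, continuous (fun x => f x 0 i)}.
  apply: (continuous_comp (g := fun M : 'rV[R]_3 => M 0 i)) => //; exact: coord_continuous.
have gi i : {for s, continuous (fun x => g x 0 i)}.
  apply: (continuous_comp (g := fun M : 'rV[R]_3 => M 0 i)) => //; exact: coord_continuous.
have -> : (fun x => dot (f x) (g x)) = fun x => f x 0 0 * g x 0 0 +
    f x 0 1 * g x 0 1 + f x 0 2 * g x 0 2 by apply/funext => x; exact: dot3E.
by apply: continuousD; [apply: continuousD|]; apply: continuousM.
Qed.

Lemma derivable_continuous_at (V : normedModType R) (f : R -> V) s :
  derivable f s 1 -> {for s, continuous f}.
Proof. by move=> fs; exact/differentiable_continuous/derivable1_diffP. Qed.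

(** Identities between curves are known on I only; openness turns them into identities near s, along
    which derivatives and limits can be transferred. *)
Lemma open_near_eq (T : Type) (I : set R) (f g : R -> T) s :
  open I -> I s -> (forall x, I x -> f x = g x) -> \near s, f s = g s.
Proof.
move=> Iopen Is fg; near=> x; apply: fg.
by near: x; exact: open_nbhs_nbhs.
Unshelve. all: by end_near. Qed.

(** The tool for differentiating the relations between frame vectors, which hold on I only. *)
Lemma is_derive_cst_on (I : set R) (k : R) h s dh :
  open I -> I s -> (forall x, I x -> h x = k) -> is_derive s 1 h dh -> dh = 0.
Proof.
move=> Iopen Is hk hs.
have : is_derive s 1 (cst k) dh.
  apply: near_eq_is_derive hs; exact: (open_near_eq _ I _ (cst k)).
by move/@derive_val => <-; rewrite derive_cst.
Qed.

(** Mean value theorem on the segment [x, y], which lies in I because I is an interval. *)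
Lemma interval_derive0_cst (I : set R) h :
  is_interval I -> (forall s, I s -> is_derive s 1 h 0) ->
  forall x y, I x -> I y -> h x = h y.
Proof.
move=> Iitv dh x y.
wlog xy : x y / x <= y.
  by move=> W Ix Iy; case/orP: (le_total x y) => ?; [|symmetry]; exact: W.
move=> Ix Iy.
have II z : z \in `[x, y]%R -> I z.
  by rewrite in_itv /= => zxy; exact: (Iitv x y).
have [|| z _ ] := @MVT_segment R h (cst 0) x y xy.
- by move=> z zxy; apply: dh; apply: II; exact: subset_itv_oo_cc.
- apply: derivable_within_continuous => z zxy.
  by have [] := dh z (II z zxy).
by rewrite mul0r => /eqP; rewrite subr_eq0 => /eqP.
Qed.

End VectorCalculus.

(** * The Frenet frame of a curve of class C^3 and its derivative formulas *)

Section FrenetFrame.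
Context {R : realType} (I : set R) (alpha : R -> 'rV[R]_3).
Hypotheses (Iopen : open I) (alphaF : Frenet_curve I alpha).
Local Notation T := (tangent alpha).
Local Notation N := (normal alpha).
Local Notation B := (binormal alpha).
Local Notation kappa := (curvature alpha).
Implicit Types s : R.

Lemma curvature_neq0 s : I s -> kappa s != 0.
Proof. by case: alphaF => _ _; exact. Qed.

Lemma dot_tangent s : I s -> dot (T s) (T s) = 1.
Proof. by case: alphaF => _ aU _ Is; exact/dot_eq1/aU. Qed.

Lemma dot_normal s : I s -> dot (N s) (N s) = 1.
Proof.
move=> Is; rewrite dotZl dotZr -sqr_enorm mulrA -expr2 -exprMn.
by rewrite mulVf ?expr1n//; exact: curvature_neq0.
Qed.

Lemma derive2_normal s : I s -> alpha^`(2)%classic s = kappa s *: N s.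
Proof. by move=> Is; rewrite scalerA divff ?scale1r//; exact: curvature_neq0. Qed.

Lemma is_derive_tangent s : I s -> is_derive s 1 T (kappa s *: N s).
Proof.
move=> Is; have [[aD _] _ _] := alphaF.
apply: DeriveDef; first exact: (aD 1%N).
by rewrite -derive1E -derive2_normal.
Qed.

(** Differentiating <T, T> = 1 gives 2 kappa <T, N> = 0. *)
Lemma dot_tangent_normal s : I s -> dot (T s) (N s) = 0.
Proof.
move=> Is; have := is_derive_tangent s Is => dT.
have := is_derive_cst_on I 1 _ s _ Iopen Is dot_tangent
  (is_derive_dot _ _ s _ _ dT dT).
rewrite dotZl dotZr [dot (N s) _]dotC => /eqP.
rewrite -mulr2n -mulr_natl !mulf_eq0 pnatr_eq0 /=.
by rewrite (negbTE (curvature_neq0 s Is)) => /eqP.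
Qed.

Lemma dot_binormal s : I s -> dot (B s) (B s) = 1.
Proof.
move=> Is; rewrite dot_cross2 dot_tangent// dot_normal// dot_tangent_normal//.
by rewrite expr0n mulr1 subr0.
Qed.

Lemma Frenet_expansion s w : I s ->
  w = dot w (T s) *: T s + dot w (N s) *: N s + dot w (B s) *: B s.
Proof.
move=> Is; apply: orthonormal_expansion.
- exact: dot_tangent.
- exact: dot_normal.
- exact: dot_tangent_normal.
Qed.

(** The curvature is the square root of <alpha'', alpha''>, which is positive at s, where the square
    root is therefore differentiable. *)
Lemma derivable_curvature s : I s -> derivable kappa s 1.
Proof.
move=> Is; have [[aD _] _ _] := alphaF.
have /derivableP d2 : derivable alpha^`(2)%classic s 1 by exact: aD.
have d22 := is_derive_dot _ _ s _ _ d2 d2.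
have d0 : 0 < dot (alpha^`(2)%classic s) (alpha^`(2)%classic s).
  by rewrite -sqr_enorm exprn_even_gt0 ?curvature_neq0.
have := is_derive1_comp (is_derive1_sqrt d0) d22.
by case.
Qed.

Lemma derivable_normal s : I s -> derivable N s 1.
Proof.
move=> Is; have [[aD _] _ _] := alphaF.
apply: derivable_scale; last exact: aD.
by apply: derivableV; [exact: curvature_neq0|exact: derivable_curvature].
Qed.

Lemma derivable_binormal s : I s -> derivable B s 1.
Proof.
move=> Is; apply: derivable_cross; last exact: derivable_normal.
by have [] := is_derive_tangent s Is.
Qed.

Lemma dot_binormal_tangent s : dot (B s) (T s) = 0.
Proof. exact: dot_crossl. Qed.

Lemma dot_binormal_normal s : dot (B s) (N s) = 0.
Proof. exact: dot_crossr. Qed.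

Definition torsion s := - dot ('D_1 B s) (N s).

(** In the frame, B' has no B component since <B, B> = 1, and no T component since <B, T> = 0 gives
    <B', T> = - kappa <B, N> = 0. *)
Lemma is_derive_binormal s : I s -> is_derive s 1 B (- torsion s *: N s).
Proof.
move=> Is; have dB := derivableP (derivable_binormal s Is).
have dT := is_derive_tangent s Is.
have BB : dot ('D_1 B s) (B s) = 0.
  have := is_derive_cst_on I 1 _ s _ Iopen Is dot_binormal
    (is_derive_dot _ _ s _ _ dB dB).
  rewrite [dot (B s) _]dotC => /eqP.
  by rewrite -mulr2n -mulr_natl mulf_eq0 pnatr_eq0 /= => /eqP.
have BT : dot ('D_1 B s) (T s) = 0.
  have := is_derive_cst_on I 0 _ s _ Iopen Is
    (fun x _ => dot_binormal_tangent x) (is_derive_dot _ _ s _ _ dB dT).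
  by rewrite dotZr dot_binormal_normal mulr0 addr0.
rewrite [X in is_derive _ _ _ X](_ : _ = 'D_1 B s)//.
rewrite [RHS](Frenet_expansion s _ Is) BB BT !scale0r add0r addr0.
by rewrite opprK.
Qed.

(** Obtained by differentiating <alpha'', B> = 0. Unlike the definition through B', this form makes
    the continuity of the torsion visible for alpha of class C^3. *)
Lemma torsionE s : I s -> torsion s = (kappa s)^-1 * dot (alpha^`(3)%classic s) (B s).
Proof.
move=> Is; have [[aD _] _ _] := alphaF.
have /derivableP d2 : derivable alpha^`(2)%classic s 1 by exact: aD.
have a2B x : I x -> dot (alpha^`(2)%classic x) (B x) = 0.
  by move=> Ix; rewrite derive2_normal// dotZl dotC dot_binormal_normal mulr0.
have := is_derive_cst_on I 0 _ s _ Iopen Is a2B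
  (is_derive_dot _ _ s _ _ d2 (is_derive_binormal s Is)).
rewrite -derive1E derive2_normal// dotZl dotZr dot_normal// mulr1 mulrN.
move=> /eqP; rewrite subr_eq0 => /eqP ->.
by rewrite mulKf ?curvature_neq0.
Qed.

Lemma continuous_torsion s : I s -> {for s, continuous torsion}.
Proof.
move=> Is; have [[_ aC] _ _] := alphaF.
have c : {for s, continuous
    (fun x => (kappa x)^-1 * dot (alpha^`(3)%classic x) (B x))}.
  apply: continuousM.
    apply: derivable_continuous_at.
    by apply: derivableV; [exact: curvature_neq0|exact: derivable_curvature].
  apply: continuous_dot; first exact: aC.
  by apply: derivable_continuous_at; exact: derivable_binormal.
rewrite /prop_for /continuous_at torsionE//.
apply: cvg_trans c; apply: near_eq_cvg.
by apply: open_near_eq Is _ => // x Ix; rewrite torsionE.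
Qed.

(** Differentiate <B, N> = 0 and use B' = - tau N. *)
Lemma dot_derive_normal_binormal s : I s ->
  dot ('D_1 N s) (B s) = torsion s.
Proof.
move=> Is.
have := is_derive_cst_on I 0 _ s _ Iopen Is
  (fun x _ => dot_binormal_normal x)
  (is_derive_dot _ _ s _ _ (is_derive_binormal s Is)
     (derivableP (derivable_normal s Is))).
rewrite dotZl dot_normal// mulr1 dotC addrC => /eqP.
by rewrite subr_eq0 dotC => /eqP.
Qed.

End FrenetFrame.

(** The product c(x) c(s) is continuous in x and positive at x = s, hence positive near s, where
    both factors then have the same sign. *)
Lemma near_sgr (R : realType) (c : R -> R) (s : R) :
  {for s, continuous c} -> c s != 0 ->
  \forall x \near s, Num.sg (c x) = Num.sg (c s).
Proof.
move=> cc cs0.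
have ccs : {for s, continuous (fun x => c x * c s)}.
  by apply: continuousM => //; exact: cst_continuous.
near=> x.
have : 0 < c x * c s.
  near: x; apply: (cvgr_gt _ ccs).
  by rewrite -expr2 exprn_even_gt0.
rewrite -sgr_cp0 sgrM => /eqP xs.
have ss : Num.sg (c s) * Num.sg (c s) = 1 by rewrite -expr2 sqr_sg cs0.
by rewrite -[LHS]mulr1 -ss mulrA xs mul1r.
Unshelve. all: by end_near. Qed.

(** * The osculating-direction curve and the two helix conditions *)

Section OsculatingDirection.
Context {R : realType} (I : set R) (alpha gamma : R -> 'rV[R]_3).
Hypotheses (Iopen : open I) (Iitv : is_interval I) (I0 : I !=set0).
Hypotheses (alphaF : Frenet_curve I alpha)
  (gammaO : osculating_direction_curve I alpha gamma).
Local Notation T := (tangent alpha).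
Local Notation N := (normal alpha).
Local Notation B := (binormal alpha).
Local Notation kappa := (curvature alpha).
Local Notation tau := (torsion alpha).
Implicit Types s : R.

(** The witness is c = v tau. Its continuity is recorded because it makes the sign of c locally
    constant. *)
Lemma osculating_direction_derive : exists2 c : R -> R,
  forall s, I s -> [/\ {for s, continuous c}, c s != 0 & tau s != 0] &
  forall s, I s -> is_derive s 1 (tangent gamma) (c s *: B s).
Proof.
have [X [u [v XE]] gX] := gammaO.
have gE s : I s -> tangent gamma s = X s.
  by move=> Is; rewrite /tangent derive1E; have [_] := gX s Is.
have XB s : I s -> dot (X s) (B s) = 0.
  move=> Is; have [_ _ -> _ _] := XE s Is.
  rewrite dotDl (dotZl (u s)) (dotZl (v s)) [dot (T s) _]dotC [dot (N s) _]dotC.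
  by rewrite dot_binormal_tangent dot_binormal_normal !mulr0 addr0.
(* Differentiating <X, B> = 0 gives c - tau <X, N> = 0, and <X, N> = v. *)
have cE s c : I s -> is_derive s 1 X (c *: B s) -> c = v s * tau s.
  move=> Is dX; have [_ _ Xs _ _] := XE s Is.
  have := is_derive_cst_on I 0 _ s _ Iopen Is XB
    (is_derive_dot _ _ s _ _ dX (is_derive_binormal I _ Iopen alphaF s Is)).
  rewrite dotZl (dot_binormal I)// mulr1 dotZr.
  rewrite Xs dotDl (dotZl (u s)) (dotZl (v s)).
  rewrite (dot_tangent_normal I)// (dot_normal I)// mulr0 add0r mulr1 mulNr.
  by move=> /eqP; rewrite subr_eq0 mulrC => /eqP.
exists (fun s => v s * tau s) => s Is;
  have [[_ dv] [_ v0] _ _ [c c0 dX]] := XE s Is.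
  have := c0; rewrite (cE s c)// => vt0; split=> //.
    apply: continuousM; first exact: derivable_continuous_at.
    exact: (continuous_torsion I).
  by move: vt0; rewrite mulf_eq0 negb_or => /andP[].
apply: near_eq_is_derive (_ : is_derive s 1 X _).
  by apply: open_near_eq Is _ => // x Ix; rewrite gE.
by rewrite -(cE s c).
Qed.

Lemma unit_speed_osculating_direction : unit_speed I gamma.
Proof.
move=> s Is; have [X [u [v XE]] gX] := gammaO.
have [_ _ _ <- _] := XE s Is.
by rewrite /tangent derive1E; have [_ ->] := gX s Is.
Qed.

Lemma class_C2_osculating_direction : class_C 2 I gamma.
Proof.
have [c c0 dg] := osculating_direction_derive.
have [X _ gX] := gammaO.
split=> [[|[|//]] s _ Is|s Is].
- by have [] := gX s Is.
- by have [] := dg s Is.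
have cB : {for s, continuous (fun x => c x *: B x)}.
  apply: continuousZ; first by have [] := c0 s Is.
  by apply: derivable_continuous_at; exact: (derivable_binormal I).
have g2 x : I x -> gamma^`(2)%classic x = c x *: B x.
  by move=> Ix; rewrite /= derive1E; have [_ ->] := dg x Ix.
rewrite /prop_for /continuous_at g2//.
apply: cvg_trans cB; apply: near_eq_cvg.
by apply: open_near_eq Is _ => // x Ix; rewrite g2.
Qed.

(** Since gamma'' = c B with B of length 1, the curvature of gamma is |c| and its principal normal
    is (c / |c|) B. *)
Lemma normal_osculating_direction : exists2 c : R -> R,
  forall s, I s -> [/\ {for s, continuous c}, c s != 0 & tau s != 0] &
  forall s, I s -> curvature gamma s != 0 /\
    normal gamma s = Num.sg (c s) *: B s.
Proof.
have [c c0 dg] := osculating_direction_derive.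
exists c => // s Is.
have [_ cs0 _] := c0 s Is.
have g2 : gamma^`(2)%classic s = c s *: B s.
  by rewrite /= derive1E; have [_ ->] := dg s Is.
have k : curvature gamma s = `|c s|.
  by rewrite /curvature g2 enormZ /enorm (dot_binormal I)// sqrtr1 mulr1.
split; first by rewrite k normr_eq0.
rewrite /normal k g2 scalerA {2}[c s]numEsg mulrCA mulVf ?mulr1//.
by rewrite normr_eq0.
Qed.

(** Near s the sign of c can be frozen at its value at s, so only B is differentiated. The factor
    [d] does not depend on w. *)
Lemma is_derive_dot_normal_osculating_direction : exists2 d : R -> R,
  forall s, I s -> d s != 0 &
  forall s w, I s ->
    is_derive s 1 (fun x => dot (normal gamma x) w) (d s * dot (N s) w).
Proof.
have [c c0 nE] := normal_osculating_direction.
exists (fun s => - (Num.sg (c s) * tau s)) => [s Is|s w Is].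
  by have [_ ? ?] := c0 s Is; rewrite oppr_eq0 mulf_neq0 ?sgr_eq0.
have [cc cs0 _] := c0 s Is.
apply: near_eq_is_derive
  (_ : is_derive s 1 (fun x => dot (Num.sg (c s) *: B x) w) _).
  near=> x; have [|_ ->] := nE x.
    by near: x; exact: open_nbhs_nbhs.
  congr (dot (_ *: _) w); apply/esym; near: x; exact: near_sgr.
have dB := is_derive_binormal I _ Iopen alphaF s Is.
have := is_derive_dot _ _ s _ _
  (is_deriveZ (Num.sg (c s)) dB) (is_derive_cst w s 1).
move/is_derive_eq; apply.
by rewrite dotZl dotZl mulrA mulrN dot0r addr0.
Unshelve. all: by end_near. Qed.

(** The derivative of <N_gamma, w> is a nonzero multiple of <N, w>. The converse direction takes as
    constant the value at a point of I. *)
Lemma dot_normal_cst_normal_osculating_direction w :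
  (exists k, forall s, I s -> dot (normal gamma s) w = k) <->
  (forall s, I s -> dot (N s) w = 0).
Proof.
have [d d0 dN] := is_derive_dot_normal_osculating_direction.
split=> [[k kE] s Is|Nw].
  have := is_derive_cst_on I k _ s _ Iopen Is kE (dN s w Is).
  by move=> /eqP; rewrite mulf_eq0 (negbTE (d0 s Is)) => /eqP.
case: I0 => s0 Is0; exists (dot (normal gamma s0) w) => s Is.
apply: (interval_derive0_cst I (fun x => dot (normal gamma x) w)) => // x Ix.
rewrite -[0](mulr0 (d x)) -(Nw x Ix).
exact: dN.
Qed.

(** The same argument for T, with the nonzero factor kappa. *)
Lemma dot_tangent_cst_normal w :
  (exists k, forall s, I s -> dot (T s) w = k) <->
  (forall s, I s -> dot (N s) w = 0).
Proof.
have dT s : I s -> is_derive s 1 (fun x => dot (T x) w) (kappa s * dot (N s) w).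
  move=> Is; have dT := is_derive_tangent I _ alphaF s Is.
  have := is_derive_dot _ _ s _ _ dT (is_derive_cst w s 1).
  move/is_derive_eq; apply.
  by rewrite dotZl dot0r addr0.
split=> [[k kE] s Is|Nw].
  have := is_derive_cst_on I k _ s _ Iopen Is kE (dT s Is).
  move=> /eqP; rewrite mulf_eq0.
  by rewrite (negbTE (curvature_neq0 I _ alphaF s Is)) => /eqP.
case: I0 => s0 Is0; exists (dot (T s0) w) => s Is.
apply: (interval_derive0_cst I (fun x => dot (T x) w)) => // x Ix.
rewrite -[0](mulr0 (kappa x)) -(Nw x Ix).
exact: dT.
Qed.

Lemma enorm_normal_osculating_direction s : I s -> enorm (normal gamma s) = 1.
Proof.
move=> Is; have [c c0 nE] := normal_osculating_direction.
have [_ cs0 _] := c0 s Is; have [_ ->] := nE s Is.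
by rewrite enormZ normr_sg cs0 mul1r /enorm (dot_binormal I)// sqrtr1.
Qed.

(** This is what excludes the angle pi / 2 in the definition of a general helix. *)
Lemma dot_tangent_neq0 w s : I s -> w != 0 ->
  (forall x, I x -> dot (N x) w = 0) -> dot (T s) w != 0.
Proof.
move=> Is w0 Nw; apply: contra_neq w0 => Tw.
have := Frenet_expansion I _ Iopen alphaF s w Is.
rewrite (dotC w (T s)) Tw (dotC w (N s)) Nw// !scale0r !add0r => wB.
have dNw := is_derive_dot _ _ s _ _
  (derivableP (derivable_normal I _ alphaF s Is)) (is_derive_cst w s 1).
have := is_derive_cst_on I 0 _ s _ Iopen Is Nw dNw.
(* With w = <w, B> B, the relation <N', w> = 0 reads <w, B> tau = 0. *)
rewrite dot0r addr0 wB dotZr (dot_derive_normal_binormal I)// => /eqP.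
have [c c0 _] := osculating_direction_derive; have [_ _ tau0] := c0 s Is.
by rewrite mulf_eq0 (negbTE tau0) orbF => /eqP ->; rewrite scale0r.
Qed.

(** The same axis w serves both curves, through the common condition <N, w> = 0. Only the angle
    changes: it is the one between w and the relevant unit vector at the base point [s0]. *)
Lemma general_helix_slant_helix :
  general_helix I alpha <-> slant_helix I gamma.
Proof.
case: (I0) => s0 Is0.
split=> [[_ _ [w [theta [w1 _ _ Tw]]]]|[_ _ _ [w [theta [w1 _ nw]]]]].
  have Nw : forall s, I s -> dot (N s) w = 0.
    by apply/dot_tangent_cst_normal; exists (cos theta).
  have [k kE] := (dot_normal_cst_normal_osculating_direction w).2 Nw.
  have [c _ nE] := normal_osculating_direction.
  have [phi phipi nphi] := unit_dot_angle _ _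
    (enorm_normal_osculating_direction s0 Is0) w1.
  split; first exact: class_C2_osculating_direction.
  - exact: unit_speed_osculating_direction.
  - by move=> s /nE[].
  - exists w, phi; split=> [//|//|s Is].
    exact: etrans (kE s Is) (etrans (esym (kE s0 Is0)) nphi).
have Nw : forall s, I s -> dot (N s) w = 0.
  by apply/dot_normal_cst_normal_osculating_direction; exists (cos theta).
have [k kE] := (dot_tangent_cst_normal w).2 Nw.
have [[aD _] aU _] := alphaF.
have [phi phipi Tphi] := unit_dot_angle _ _ (aU s0 Is0) w1.
split=> //.
  split=> [[|//] s _ Is|s Is]; first exact: (aD 0%N).
  by apply: derivable_continuous_at; exact: (aD 1%N).
exists w, phi; split=> [//|//||s Is]; last first.
  exact: etrans (kE s Is) (etrans (esym (kE s0 Is0)) Tphi).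
have w0 : w != 0.
  apply: contra_eq_neq w1 => ->.
  by rewrite -(scale0r (0 : 'rV[R]_3)) enormZ normr0 mul0r eq_sym oner_eq0.
(* The angle pi / 2 would give <T, w> = 0 at [s0]. *)
apply: contra_neq (dot_tangent_neq0 w s0 Is0 w0 Nw) => phiE.
by rewrite Tphi phiE cos_pihalf.
Qed.

End OsculatingDirection.

Theorem theorem4p1 (R : realType) (I : set R) (alpha gamma : R -> 'rV[R]_3)
    (I_nonempty : I !=set0) (I_open : open I) (I_interval : is_interval I)
    (alpha_Frenet : Frenet_curve I alpha)
    (gamma_direction : osculating_direction_curve I alpha gamma) :
  (general_helix I alpha <->
    (exists beta : R -> 'rV[R]_3,
       slant_helix I beta /\ osculating_donor_curve I beta alpha)) /\
  (general_helix I alpha <-> slant_helix I gamma).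
Proof.
(* The equivalence is kept for an arbitrary osculating-direction curve: [gamma] serves as witness
   for (ii), and conversely any [beta] given by (ii) makes alpha a general helix. *)
have helixE beta : osculating_direction_curve I alpha beta ->
    general_helix I alpha <-> slant_helix I beta.
  exact: general_helix_slant_helix.
split; last exact: helixE.
split=> [ah|[beta [bs bo]]]; last exact/(helixE beta).
by exists gamma; split=> //; exact/helixE.
Qed.
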